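(* For every real number $\varepsilon>0$ there is a real number $\delta>0$ such that for every circuit $\mathcal P$ on the unit circle $\mathscr C$, $$\mu(\mathcal P)<\delta \quad\text{implies that}\quad 0<2\pi-\pi(g(\mathcal P))<\varepsilon \quad\text{and}\quad 0<\pi(G(\mathcal P))-2\pi<\varepsilon .$$
   Context: $\mathscr C$ is the unit circle centered at $O$. A circuit on $\mathscr C$ is a finite sequence $\mathcal P=(P_1,\dots,P_{n+1})$ of points on $\mathscr C$ in counterclockwise order (going once around $\mathscr C$, with $P_1,\dots,P_n$ distinct) such that $P_{n+1}=P_1$; it is assumed throughout that the counterclockwise arc from each point of a circuit to the next is less than half of $\mathscr C$. The inscribed polygon $g(\mathcal P)$ is the polygon with vertices $P_1,\dots,P_n$ and edges $\overline{P_iP_{i+1}}$. The circumscribed polygon $G(\mathcal P)$ is the polygon whose vertices are the intersections of the lines tangent to $\mathscr C$ at adjacent points of the circuit. For a polygon $P$, $\pi(P)$ denotes its perimeter. The mesh $\mu(\mathcal P)$ is the maximal edge length of $g(\mathcal P)$. The number $2\pi$ is defined as $2\pi=\lim_{m\to\infty}p_3(m)$, where $p_3(m)$ is the perimeter of a regular polygon with $3\cdot 2^m$ edges inscribed in $\mathscr C$. *)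

(* Defs.v *)
From Stdlib Require Export Reals List.
From Coquelicot Require Export Rbar Lim_seq.
From Coquelicot Require Import Hierarchy Continuity ElemFct.
From Stdlib Require Import Lra Lia.
Export ListNotations.
Open Scope R_scope.

Definition point : Type := (R * R)%type.

Definition dist (A B : point) : R := dist_euc (fst A) (snd A) (fst B) (snd B).

(** A polygon is the list of its vertices in cyclic order; the last vertex is
    joined to the first one, which is not repeated. *)
Definition edges (V : list point) : list (point * point) :=
  combine V (tl V ++ firstn 1 V).

Definition edge_lengths (V : list point) : list R :=
  map (fun e => dist (fst e) (snd e)) (edges V).

Definition perimeter (V : list point) : R :=
  fold_right Rplus 0 (edge_lengths V).

Definition max_edge_length (V : list point) : R :=
  fold_right Rmax 0 (edge_lengths V).

Definition circle_point (t : R) : point := (cos t, sin t).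

(** [P] lists [P_1, ..., P_(n+1)], with [theta i] a polar
    angle of [P_(i+1)].  Increasing angles express the counterclockwise order,
    and the total increase [2 * PI] says that the circuit goes around exactly
    once and closes up.  The arc from each point to the next has angular size
    [theta (S i) - theta i], so the bound by [PI] says that it is less than
    half of the circle.  That [P_(n+1) = P_1] and that [P_1, ..., P_n] are
    distinct points of the unit circle follows: see [circuit_on_circle],
    [circuit_closed] and [circuit_NoDup]. *)
Definition circuit (P : list point) : Prop :=
  exists (n : nat) (theta : nat -> R),
    P = map (fun i => circle_point (theta i)) (seq 0 (S n)) /\
    (forall i : nat, (i < n)%nat -> theta i < theta (S i) < theta i + PI) /\
    theta n = theta 0%nat + 2 * PI.

Definition inscribed (P : list point) : list point := removelast P.

Definition mesh (P : list point) : R := max_edge_length (inscribed P).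

(** The line through [A] perpendicular to [OA]. *)
Definition on_tangent (A X : point) : Prop :=
  (fst X - fst A) * fst A + (snd X - snd A) * snd A = 0.

(** The intersection of the tangents at the points [A] and [B] of the unit
    circle, by Cramer's rule; it is characterised by [tangent_meet_spec].  The
    value is irrelevant when [A] and [B] are equal or antipodal, which does
    not happen for adjacent points of a circuit: see [circuit_adjacent]. *)
Definition tangent_meet (A B : point) : point :=
  let d := fst A * snd B - snd A * fst B in
  ((snd B - snd A) / d, (fst A - fst B) / d).

Definition circumscribed (P : list point) : list point :=
  map (fun e => tangent_meet (fst e) (snd e)) (combine P (tl P)).

Definition regular_polygon (N : nat) : list point :=
  map (fun k => circle_point (2 * PI * INR k / INR N)) (seq 0 N).

Definition p3 (m : nat) : R := perimeter (regular_polygon (3 * 2 ^ m)).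

(** The limit exists and is finite: see [is_lim_p3]. *)
Definition two_pi : R := real (Lim_seq p3).

Lemma circuit_on_circle (P : list point) :
  circuit P -> forall A, In A P -> fst A ^ 2 + snd A ^ 2 = 1.
Proof.
intros [n [th [-> _]]] A HA.
apply in_map_iff in HA; destruct HA as [i [<- _]]; cbn [fst snd circle_point].
generalize (sin2_cos2 (th i)); unfold Rsqr; lra.
Qed.

Lemma circuit_closed (P : list point) (d : point) :
  circuit P -> last P d = hd d P.
Proof.
intros [n [th [-> [_ H]]]].
rewrite seq_S, map_app; cbn [map]; rewrite last_last; cbn.
destruct n as [|n]; cbn; unfold circle_point.
- reflexivity.
- rewrite H.
  rewrite cos_plus, sin_plus, cos_2PI, sin_2PI; f_equal; ring.
Qed.

Lemma angles_increasing (n : nat) (th : nat -> R) :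
  (forall i, (i < n)%nat -> th i < th (S i)) ->
  forall i j, (i < j <= n)%nat -> th i < th j.
Proof.
intros H i j; induction j as [|j IH]; intros Hij; [lia|].
destruct (Nat.eq_dec i j) as [->|Hne]; [apply H; lia|].
apply Rlt_trans with (th j); [apply IH; lia|apply H; lia].
Qed.

Lemma circle_point_inj (a b : R) :
  a < b < a + 2 * PI -> circle_point a <> circle_point b.
Proof.
intros Hab E; injection E as Ec Es.
assert (Hc : cos (b - a) = 1).
{ rewrite cos_minus, <- Ec, <- Es.
  generalize (sin2_cos2 a); unfold Rsqr; lra. }
replace (b - a) with (2 * ((b - a) / 2)) in Hc by field.
rewrite cos_2a_sin in Hc.
assert (Hs : 0 < sin ((b - a) / 2)) by (apply sin_gt_0; lra).
nra.
Qed.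

Lemma circuit_NoDup (P : list point) : circuit P -> NoDup (removelast P).
Proof.
intros [n [th [-> [H Hn]]]].
rewrite seq_S, map_app; cbn [map]; rewrite removelast_last.
assert (Hinc := angles_increasing n th (fun i Hi => proj1 (H i Hi))).
apply NoDup_map_NoDup_ForallPairs; [|apply seq_NoDup].
intros i j Hi Hj E.
apply in_seq in Hi; apply in_seq in Hj.
assert (Hlt : forall i j, (i < j < n)%nat ->
          circle_point (th i) <> circle_point (th j)).
{ intros k l Hkl; apply circle_point_inj; split; [apply Hinc; lia|].
  assert (th l < th n) by (apply Hinc; lia).
  assert (th 0%nat <= th k).
  { destruct k; [lra|]. left; apply Hinc; lia. }
  lra. }
destruct (Nat.lt_trichotomy i j) as [L|[L|L]]; [|exact L|].
- now destruct (Hlt i j ltac:(lia)).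
- now destruct (Hlt j i ltac:(lia)).
Qed.

Lemma tangent_meet_spec (A B X : point) :
  fst A ^ 2 + snd A ^ 2 = 1 -> fst B ^ 2 + snd B ^ 2 = 1 ->
  fst A * snd B - snd A * fst B <> 0 ->
  (on_tangent A X /\ on_tangent B X <-> X = tangent_meet A B).
Proof.
destruct A as [a b], B as [c d], X as [x y].
unfold on_tangent, tangent_meet; cbn -[pow]; intros HA HB Hd; split.
- intros [H1 H2].
  f_equal; apply (Rmult_eq_reg_r (a * d - b * c)); trivial.
  + replace ((d - b) / (a * d - b * c) * (a * d - b * c)) with (d - b)
      by (field; trivial).
    assert (a * x + b * y = 1) by lra.
    assert (c * x + d * y = 1) by lra.
    replace (x * (a * d - b * c))
      with (d * (a * x + b * y) - b * (c * x + d * y)) by ring.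
    rewrite H, H0; ring.
  + replace ((a - c) / (a * d - b * c) * (a * d - b * c)) with (a - c)
      by (field; trivial).
    assert (a * x + b * y = 1) by lra.
    assert (c * x + d * y = 1) by lra.
    replace (y * (a * d - b * c))
      with (a * (c * x + d * y) - c * (a * x + b * y)) by ring.
    rewrite H, H0; ring.
- intros E; injection E as -> ->; split.
  + transitivity (1 - (a ^ 2 + b ^ 2)); [field; trivial|lra].
  + transitivity (1 - (c ^ 2 + d ^ 2)); [field; trivial|lra].
Qed.

Lemma circuit_adjacent (a b : R) : a < b < a + PI ->
  fst (circle_point a) * snd (circle_point b)
    - snd (circle_point a) * fst (circle_point b) <> 0.
Proof.
intros H; cbn.
assert (0 < sin (b - a)) by (apply sin_gt_0; lra).
rewrite sin_minus in H0; lra.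
Qed.

Lemma combine_map_seq (A : Type) (f : nat -> A) (k n : nat) :
  combine (map f (seq k n)) (map f (seq (S k) n))
    = map (fun i => (f i, f (S i))) (seq k n).
Proof. revert k; induction n; intros k; cbn; [|f_equal]; auto. Qed.

Lemma edges_map_seq (f : nat -> point) (n : nat) : f n = f 0%nat ->
  edges (map f (seq 0 n)) = map (fun i => (f i, f (S i))) (seq 0 n).
Proof.
destruct n as [|n]; [reflexivity|]; intros E; unfold edges.
rewrite <- combine_map_seq; f_equal.
rewrite (seq_S n 1), map_app; cbn; now rewrite E.
Qed.

Lemma dist_circle_point (a b : R) : a <= b <= a + 2 * PI ->
  dist (circle_point a) (circle_point b) = 2 * sin ((b - a) / 2).
Proof.
intros H; unfold dist, dist_euc; cbn.
assert (Hs : 0 <= sin ((b - a) / 2)) by (apply sin_ge_0; lra).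
rewrite <- (sqrt_Rsqr (2 * sin ((b - a) / 2))) by lra.
f_equal.
assert (E : cos (b - a) = 1 - 2 * sin ((b - a) / 2) * sin ((b - a) / 2)).
{ rewrite <- cos_2a_sin; f_equal; field. }
rewrite cos_minus in E.
generalize (sin2_cos2 a) (sin2_cos2 b); unfold Rsqr; lra.
Qed.

Lemma regular_polygon_edges (N : nat) : (0 < N)%nat ->
  edge_lengths (regular_polygon N) = repeat (2 * sin (PI / INR N)) N.
Proof.
intros HN; assert (HN' : 0 < INR N) by now apply lt_0_INR.
unfold edge_lengths, regular_polygon; rewrite edges_map_seq.
- replace (repeat (2 * sin (PI / INR N)) N)
    with (map (fun _ => 2 * sin (PI / INR N)) (seq 0 N))
    by now rewrite map_const, length_seq.
  rewrite map_map; apply map_ext; intros i; cbn [fst snd].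
  rewrite dist_circle_point.
  + do 2 f_equal; rewrite S_INR; field; lra.
  + rewrite S_INR.
    replace (2 * PI * (INR i + 1) / INR N)
      with (2 * PI * INR i / INR N + 2 * PI * / INR N) by (field; lra).
    assert (0 < PI) by apply PI_RGT_0.
    assert (0 < / INR N) by now apply Rinv_0_lt_compat.
    assert (/ INR N <= 1).
    { rewrite <- Rinv_1; apply Rinv_le_contravar; [lra|].
      apply (le_INR 1); lia. }
    nra.
- unfold circle_point.
  replace (2 * PI * INR N / INR N) with (2 * PI) by (field; lra).
  replace (2 * PI * INR 0 / INR N) with 0 by (cbn; field; lra).
  now rewrite cos_2PI, sin_2PI, cos_0, sin_0.
Qed.

Lemma is_lim_p3 : is_lim_seq p3 two_pi.
Proof.
set (N := fun m : nat => INR (3 * 2 ^ m)).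
assert (HN0 : forall m, (0 < 3 * 2 ^ m)%nat).
{ intros m; generalize (Nat.pow_nonzero 2 m); lia. }
assert (HN : forall m, 0 < N m) by (intros m; apply lt_0_INR, HN0).
assert (Hp : forall m, p3 m = N m * (2 * sin (PI / N m))).
{ intros m; unfold p3, perimeter; rewrite regular_polygon_edges by apply HN0.
  fold (N m); generalize (2 * sin (PI / N m)); intros r; unfold N.
  generalize (3 * 2 ^ m)%nat; intros k.
  induction k; [cbn; ring|].
  rewrite S_INR; cbn [repeat fold_right]; rewrite IHk; ring. }
assert (Hu : is_lim_seq (fun m => PI / N m) 0).
{ apply is_lim_seq_ext with (fun m => PI / 3 * (/ 2) ^ m).
  - intros m; unfold N; rewrite mult_INR, pow_INR, pow_inv.
    replace (INR 3) with 3 by (cbn; ring).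
    replace (INR 2) with 2 by (cbn; ring).
    field; apply pow_nonzero; lra.
  - replace (Finite 0) with (Rbar_mult (PI / 3) 0)
      by (cbn; f_equal; ring).
    apply is_lim_seq_scal_l, is_lim_seq_geom.
    rewrite Rabs_pos_eq; lra. }
assert (HP := PI_RGT_0).
apply Lim_seq_correct'; exists (2 * PI).
apply is_lim_seq_ext with
  (fun m => 2 * PI * (sin (PI / N m) / (PI / N m))).
- intros m; rewrite Hp; specialize (HN m); field; lra.
- replace (Finite (2 * PI)) with (Rbar_mult (2 * PI) 1)
    by (cbn; f_equal; ring).
  apply is_lim_seq_scal_l.
  apply (is_lim_comp_seq (fun x => sin x / x) (fun m => PI / N m) 0 1);
    [exact is_lim_sinc_0| |exact Hu].
  exists 0%nat; intros m _ E; injection E as E.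
  specialize (HN m); assert (0 < PI / N m) by now apply Rdiv_lt_0_compat.
  lra.
Qed.

(* Main.v *)
(** If [2 h_i] are the angular gaps of the circuit, then the sum of the [h_i] is
    [PI], the inscribed perimeter is the sum of the [2 sin h_i] and the
    circumscribed one is the sum of the [2 tan h_i].  Since
    [sin h < h < tan h], the limit [2 PI] lies strictly between them; since
    [cos h >= 1 - sin h] and [sin h_i < delta / 2], both sums differ from
    [2 PI] by at most a multiple of [delta]. *)

Require Import Defs.
From Stdlib Require Import Lra Lia.

(** * Estimates for sine and tangent *)

(** By the mean value theorem [sin h = h * cos c] with [0 < c < h], and cosine decreases on
    [[0, PI]]. *)
Lemma mul_cos_lt_sin (h : R) : 0 < h < PI -> h * cos h < sin h.
Proof.
intros H.
destruct (MVT_cor2 sin cos 0 h ltac:(lra)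
            (fun c _ => derivable_pt_lim_sin c)) as [c [E Hc]].
rewrite sin_0 in E.
assert (cos h < cos c) by (apply cos_decreasing_1; lra).
nra.
Qed.

(** Both values are nonnegative, so the square of [sin h + cos h] is [1 + 2 * sin h * cos h >= 1].
    This turns a short chord into a cosine close to 1. *)
Lemma one_minus_sin_le_cos (h : R) : 0 <= h <= PI / 2 -> 1 - sin h <= cos h.
Proof.
intros H.
assert (0 <= sin h) by (apply sin_ge_0; lra).
assert (0 <= cos h) by (apply cos_ge_0; lra).
generalize (sin2_cos2 h); unfold Rsqr; nra.
Qed.

Lemma sin_bounds (h d : R) : 0 < h < PI / 2 -> sin h < d / 2 ->
  h * (1 - d / 2) < sin h < h.
Proof.
intros H Hd; split; [|apply sin_lt_x; lra].
assert (h * cos h < sin h) by (apply mul_cos_lt_sin; lra).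
assert (1 - sin h <= cos h) by (apply one_minus_sin_le_cos; lra).
nra.
Qed.

Lemma tan_bounds (h d : R) : 0 < h < PI / 2 -> d <= 1 -> sin h < d / 2 ->
  h < tan h < h * (1 + d).
Proof.
intros H Hd1 Hd.
assert (h * cos h < sin h) by (apply mul_cos_lt_sin; lra).
assert (1 - sin h <= cos h) by (apply one_minus_sin_le_cos; lra).
assert (sin h < h) by (apply sin_lt_x; lra).
assert (0 < sin h) by (apply sin_gt_0; lra).
assert (Hc : 0 < cos h) by (apply cos_gt_0; lra).
assert (E : tan h * cos h = sin h) by (unfold tan; field; lra).
split; apply Rmult_lt_reg_r with (cos h); trivial; rewrite E; [lra|].
(* The product is [1 + d * (1 - d) / 2], and [0 < d <= 1]. With [cos h > 1 - d / 2] this gives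
   [sin h < h <= h * (1 + d) * cos h]. *)
assert (1 <= (1 + d) * (1 - d / 2)) by nra.
assert (1 <= (1 + d) * cos h) by nra.
nra.
Qed.

(** * Finite sums *)

Definition sum (f : nat -> R) (n : nat) : R :=
  fold_right Rplus 0 (map f (seq 0 n)).

Lemma sum_S (f : nat -> R) (n : nat) : sum f (S n) = sum f n + f n.
Proof.
unfold sum; rewrite seq_S, map_app, fold_right_app; cbn.
generalize (map f (seq 0 n)) as l.
induction l as [|x l IH]; cbn; [|rewrite IH]; ring.
Qed.

Lemma sum_lt (f g : nat -> R) (n : nat) : (0 < n)%nat ->
  (forall i, (i < n)%nat -> f i < g i) -> sum f n < sum g n.
Proof.
induction n as [|n IH]; intros Hn H; [lia|].
rewrite !sum_S; specialize (H n ltac:(lia)) as Hlast.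
destruct (Nat.eq_dec n 0) as [->|Hn0]; [cbn; lra|].
assert (sum f n < sum g n) by (apply IH; [lia|intros i Hi; apply H; lia]).
lra.
Qed.

Lemma sum_ext (f g : nat -> R) (n : nat) :
  (forall i, (i < n)%nat -> f i = g i) -> sum f n = sum g n.
Proof.
intros H; unfold sum; f_equal; apply map_ext_in.
intros i Hi; apply in_seq in Hi; apply H; lia.
Qed.

Lemma sum_plus (f g : nat -> R) (n : nat) :
  sum (fun i => f i + g i) n = sum f n + sum g n.
Proof. induction n; [cbn; ring|]. rewrite !sum_S, IHn; ring. Qed.

Lemma sum_scal (f : nat -> R) (c : R) (n : nat) :
  sum (fun i => f i * c) n = sum f n * c.
Proof. induction n; [cbn; ring|]. rewrite !sum_S, IHn; ring. Qed.

Lemma sum_telescope (f : nat -> R) (n : nat) :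
  sum (fun i => f (S i) - f i) n = f n - f 0%nat.
Proof. induction n; [cbn; ring|]. rewrite !sum_S, IHn; ring. Qed.

Lemma sum_shift (f : nat -> R) (n : nat) : f n = f 0%nat ->
  sum (fun i => f (S i)) n = sum f n.
Proof.
intros E.
rewrite (sum_ext _ (fun i => (f (S i) - f i) + f i)) by (intros; ring).
rewrite sum_plus, sum_telescope, E; ring.
Qed.

(** * Perimeter and mesh of cyclically indexed polygons *)

Lemma perimeter_map_seq (f : nat -> point) (n : nat) : f n = f 0%nat ->
  perimeter (map f (seq 0 n)) = sum (fun i => dist (f i) (f (S i))) n.
Proof.
intros E; unfold perimeter, edge_lengths, sum.
now rewrite edges_map_seq, map_map.
Qed.

Lemma max_edge_length_ge (f : nat -> point) (n i : nat) : f n = f 0%nat ->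
  (i < n)%nat -> dist (f i) (f (S i)) <= max_edge_length (map f (seq 0 n)).
Proof.
intros E Hi; unfold max_edge_length, edge_lengths.
rewrite edges_map_seq, map_map by trivial; cbn [fst snd].
assert (Hin : In i (seq 0 n)) by (apply in_seq; lia).
revert Hin; induction (seq 0 n) as [|k l IH]; cbn; [easy|].
intros [->|Hin]; [apply Rmax_l|].
apply Rle_trans with (2 := Rmax_r _ _); auto.
Qed.

(** * Intersections of tangents *)

Lemma circle_point_period (t : R) :
  circle_point (t + 2 * PI) = circle_point t.
Proof.
unfold circle_point.
now rewrite cos_plus, sin_plus, cos_2PI, sin_2PI, !Rmult_1_r, !Rmult_0_r,
  Rminus_0_r, Rplus_0_r.
Qed.

(** The intersection lies at distance [t] from both points of tangency: forwards along the tangent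
    at [a], backwards along the tangent at [b]. By [tangent_meet_spec] it suffices that each
    expression satisfies both tangent equations. *)
Lemma tangent_meet_circle_point (a b : R) : a < b < a + PI ->
  let t := tan ((b - a) / 2) in
  tangent_meet (circle_point a) (circle_point b)
    = (cos a - t * sin a, sin a + t * cos a) /\
  tangent_meet (circle_point a) (circle_point b)
    = (cos b + t * sin b, sin b - t * cos b).
Proof.
intros H t.
assert (Ha := sin2_cos2 a); assert (Hb := sin2_cos2 b).
unfold Rsqr in Ha, Hb.
(* The half-angle formula makes the tangent equations polynomial in sines and cosines of [a] and
   [b]. *)
assert (Ht : t * sin (b - a) = 1 - cos (b - a)).
{ replace (b - a) with (2 * ((b - a) / 2)) by field.
  rewrite sin_2a, cos_2a_sin; unfold t, tan; field.
  apply Rgt_not_eq, cos_gt_0; lra. }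
rewrite sin_minus, cos_minus in Ht.
assert (Hd := circuit_adjacent a b H).
split; symmetry; apply tangent_meet_spec; trivial; unfold on_tangent; cbn;
  try lra; split; nra.
Qed.

(** Both points lie on the tangent at [b], on opposite sides of the point of tangency, so the two
    tangent lengths add up. *)
Lemma dist_tangent_meet (a b c : R) : a < b < a + PI -> b < c < b + PI ->
  dist (tangent_meet (circle_point a) (circle_point b))
       (tangent_meet (circle_point b) (circle_point c))
    = tan ((b - a) / 2) + tan ((c - b) / 2).
Proof.
intros Hab Hbc.
rewrite (proj2 (tangent_meet_circle_point a b Hab)).
rewrite (proj1 (tangent_meet_circle_point b c Hbc)).
assert (0 < tan ((b - a) / 2)) by (apply tan_gt_0; lra).
assert (0 < tan ((c - b) / 2)) by (apply tan_gt_0; lra).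
unfold dist, dist_euc; cbn.
set (s := tan ((b - a) / 2)) in *; set (t := tan ((c - b) / 2)) in *.
rewrite <- (sqrt_Rsqr (s + t)) by lra; f_equal.
transitivity (Rsqr (s + t) * (Rsqr (sin b) + Rsqr (cos b)));
  [unfold Rsqr; ring|].
rewrite sin2_cos2; ring.
Qed.

(** * Half-gaps of a circuit *)

(** The angles of a circuit continued by one step, so that the last vertex of
    the circumscribed polygon is joined to the first one like any other. *)
Lemma circuit_angles (P : list point) : circuit P ->
  exists (n : nat) (theta : nat -> R), (0 < n)%nat /\
    P = map (fun i => circle_point (theta i)) (seq 0 (S n)) /\
    (forall i, (i <= n)%nat -> theta i < theta (S i) < theta i + PI) /\
    theta n = theta 0%nat + 2 * PI /\ theta (S n) = theta 1%nat + 2 * PI.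
Proof.
intros [n [th [-> [H Hn]]]].
assert (Hpos : (0 < n)%nat).
(* For [n = 0] the closing condition would say [0 = 2 * PI]. *)
{ destruct n; [|lia]. generalize PI_RGT_0; lra. }
exists n, (fun i => if (i <=? n)%nat then th i else th 1%nat + 2 * PI).
split; [trivial|split; [|split; [|split]]].
- apply map_ext_in; intros i Hi; apply in_seq in Hi.
  now rewrite (proj2 (Nat.leb_le i n)) by lia.
- intros i Hi; rewrite (proj2 (Nat.leb_le i n)) by lia.
  destruct (Nat.leb_spec (S i) n); [apply H; lia|].
  (* The added gap is the first gap shifted by a full turn. *)
  replace i with n by lia; rewrite Hn.
  specialize (H 0%nat Hpos); lra.
- now rewrite Nat.leb_refl.
- rewrite (proj2 (Nat.leb_gt (S n) n)) by lia.
  now rewrite (proj2 (Nat.leb_le 1 n)) by lia.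
Qed.

Lemma inscribed_map_seq (f : nat -> point) (n : nat) :
  inscribed (map f (seq 0 (S n))) = map f (seq 0 n).
Proof.
unfold inscribed; rewrite seq_S, map_app; apply removelast_last.
Qed.

Lemma circumscribed_map_seq (f : nat -> point) (n : nat) :
  circumscribed (map f (seq 0 (S n)))
    = map (fun i => tangent_meet (f i) (f (S i))) (seq 0 n).
Proof.
unfold circumscribed; generalize 0%nat as k.
induction n as [|n IH]; intros k; [reflexivity|].
specialize (IH (S k)); cbn in *; f_equal; exact IH.
Qed.

Lemma circuit_half_gaps (P : list point) : circuit P ->
  exists (n : nat) (h : nat -> R), (0 < n)%nat /\
    (forall i, (i < n)%nat -> 0 < h i < PI / 2 /\ 2 * sin (h i) <= mesh P) /\
    sum h n = PI /\
    perimeter (inscribed P) = sum (fun i => sin (h i)) n * 2 /\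
    perimeter (circumscribed P) = sum (fun i => tan (h i)) n * 2.
Proof.
intros HP; destruct (circuit_angles P HP) as [n [th [Hn [-> [H [E0 E1]]]]]].
assert (Hpi := PI_RGT_0).
set (h := fun i => (th (S i) - th i) / 2).
assert (Hper : circle_point (th n) = circle_point (th 0%nat))
  by (rewrite E0; apply circle_point_period).
assert (Hd : forall i, (i < n)%nat ->
  dist (circle_point (th i)) (circle_point (th (S i))) = sin (h i) * 2).
{ intros i Hi; specialize (H i ltac:(lia)).
  rewrite dist_circle_point by lra; unfold h; ring. }
exists n, h; split; [trivial|split; [|split; [|split]]].
- intros i Hi; split; [unfold h; specialize (H i ltac:(lia)); lra|].
  rewrite Rmult_comm, <- Hd by trivial.
  unfold mesh; rewrite inscribed_map_seq.
  now apply (max_edge_length_ge (fun i => circle_point (th i))).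
- unfold h, Rdiv; rewrite sum_scal, sum_telescope, E0; field.
- rewrite inscribed_map_seq, perimeter_map_seq, <- sum_scal by trivial.
  now apply sum_ext.
- rewrite circumscribed_map_seq, perimeter_map_seq.
  2:{ rewrite E1, circle_point_period; now f_equal. }
  rewrite (sum_ext _ (fun i => tan (h i) + tan (h (S i)))).
  2:{ intros i Hi; apply dist_tangent_meet; apply H; lia. }
  (* Each half-gap contributes its tangent to two neighbouring sides. Shifting the second sum
     cyclically, by [h n = h 0], gives the factor 2. *)
  rewrite sum_plus, (sum_shift (fun i => tan (h i))); [ring|].
  unfold h; f_equal; lra.
Qed.

(** * Identification of the limit with [2 * PI] *)

Lemma p3_formula (m : nat) :
  p3 m = 2 * INR (3 * 2 ^ m) * sin (PI / INR (3 * 2 ^ m)).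
Proof.
unfold p3, perimeter; rewrite regular_polygon_edges
  by (generalize (Nat.pow_nonzero 2 m); lia).
generalize (sin (PI / INR (3 * 2 ^ m))) as s; intros s.
generalize (3 * 2 ^ m)%nat as N; intros N; induction N as [|N IH]; [cbn; ring|].
rewrite S_INR; cbn [repeat fold_right]; rewrite IH; ring.
Qed.

Lemma two_pi_eq : two_pi = 2 * PI.
Proof.
unfold two_pi; rewrite (is_lim_seq_unique p3 (2 * PI)); [reflexivity|].
apply is_lim_seq_spec; intros e; assert (He := cond_pos e).
(* Since [M <= m < 2 ^ m], this makes [h = PI / N] smaller than [e / 8]. The error is below
   [2 * PI * h], hence below [e] because [PI <= 4]. *)
destruct (INR_unbounded (8 * PI / e)) as [M HM].
exists M; intros m Hm; rewrite p3_formula.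
assert (HN : (3 <= 3 * 2 ^ m)%nat) by (generalize (Nat.pow_nonzero 2 m); lia).
assert (HNM : INR M <= INR (3 * 2 ^ m)).
{ apply le_INR; generalize (Nat.pow_gt_lin_r 2 m); lia. }
apply le_INR in HN; replace (INR 3) with 3 in HN by (cbn; ring).
set (N := INR (3 * 2 ^ m)) in *.
assert (Hpi := PI_RGT_0); assert (Hpi4 := PI_4).
set (h := PI / N).
assert (EN : N * h = PI) by (unfold h; field; lra).
assert (Hh : 0 < h) by (apply Rdiv_lt_0_compat; lra).
assert (Hsmall : h < e / 8).
{ apply Rmult_lt_reg_l with N; [lra|]. rewrite EN.
  apply Rmult_lt_reg_r with (8 / e); [apply Rdiv_lt_0_compat; lra|].
  replace (N * (e / 8) * (8 / e)) with N by (field; lra).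
  lra. }
(* Written so as to apply [sin_bounds] with [d = 2 * h]. *)
assert (Hs : sin h < 2 * h / 2) by (generalize (sin_lt_x h Hh); lra).
assert (Hb : h * (1 - 2 * h / 2) < sin h < h) by (apply sin_bounds; nra).
apply Rabs_def1; nra.
Qed.

(** * Comparison of the perimeters *)

Theorem theorem5 :
  forall eps : R, 0 < eps ->
  exists delta : R, 0 < delta /\
    forall P : list point, circuit P ->
      mesh P < delta ->
      0 < two_pi - perimeter (inscribed P) < eps /\
      0 < perimeter (circumscribed P) - two_pi < eps.
Proof.
(* The bound 1 is what [tan_bounds] requires. The two differences are below [PI * d] and
   [2 * PI * d], and [2 * PI * d <= 8 * d <= eps]. *)
intros eps Heps; exists (Rmin 1 (eps / 8)).
split; [apply Rmin_pos; lra|]; intros P HP Hmesh.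
assert (Hd1 := Rmin_l 1 (eps / 8)); assert (Hd2 := Rmin_r 1 (eps / 8)).
set (d := Rmin 1 (eps / 8)) in *.
assert (Hpi := PI_RGT_0); assert (Hpi4 := PI_4).
destruct (circuit_half_gaps P HP) as [n [h [Hn [Hh [Eh [-> ->]]]]]].
rewrite two_pi_eq.
assert (Hsin : forall i, (i < n)%nat -> sin (h i) < d / 2)
  by (intros i Hi; specialize (Hh i Hi); lra).
assert (H1 : sum h n * (1 - d / 2) < sum (fun i => sin (h i)) n).
{ rewrite <- sum_scal; apply sum_lt; trivial.
  intros i Hi; apply sin_bounds; [apply Hh|]; auto. }
assert (H2 : sum (fun i => sin (h i)) n < sum h n).
{ apply sum_lt; trivial; intros i Hi; apply sin_lt_x, Hh, Hi. }
assert (H3 : sum h n < sum (fun i => tan (h i)) n).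
{ apply sum_lt; trivial; intros i Hi; apply (tan_bounds _ d); auto; now apply Hh. }
assert (H4 : sum (fun i => tan (h i)) n < sum h n * (1 + d)).
{ rewrite <- sum_scal; apply sum_lt; trivial.
  intros i Hi; apply tan_bounds; auto; now apply Hh. }
rewrite Eh in *; split; nra.
Qed.
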